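(* For every real $p \geq 2$ and every integer $n \geq 2$, $$\int_{-\frac12}^{\frac12} \left|\frac{\sin(n\pi x)}{n\sin(\pi x)}\right|^p dx < \sqrt{\frac{2}{p\,(n^2-1)}}.$$
   Context: The integrand is extended by continuity at $x=0$ (value $1$). *)

(* Defs.v *)
From mathcomp Require Import all_boot all_order all_algebra.
From mathcomp Require Import all_classical all_reals all_analysis.

Set Implicit Arguments.
Unset Strict Implicit.
Unset Printing Implicit Defensive.

Import Order.TTheory GRing.Theory Num.Theory.
Local Open Scope ring_scope.

(* The case x = 0 is the extension by continuity; without it, the convention
   0^-1 = 0 would give the value 0 there. On [-1/2, 1/2], x = 0 is the only zero
   of the denominator. *)
Definition sine_ratio_pow (R : realType) (n : nat) (p x : R) : R :=
  if x == 0 then 1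
  else `|sin (n%:R * pi * x) / (n%:R * sin (pi * x))| `^ p.

(* Main.v *)
Require Import Defs.
From mathcomp Require Import all_boot all_order all_algebra.
From mathcomp Require Import all_classical all_reals all_analysis.
From mathcomp Require Import measurable_realfun ring lra.

(** Write [t] for the square of the sine ratio: it is the Fejer kernel over
    [n ^ 2], a trigonometric polynomial of integral [1 / n]. On the main lobe
    [|x| <= 1 / n], [t <= exp (- A x ^ 2)] with [A = (n ^ 2 - 1) pi ^ 2 / 3],
    because [sin y / y * exp (y ^ 2 / 6)] decreases on [(0, pi]]; on the side
    lobes [t <= 1 / 9]. With [q = p / 2], [m = 9 ^ (1 - q)] and
    [phi u = u ^ q - m u], which is negative below [1 / 9] and increasing above,
    this gives [phi t <= max 0 (phi (exp (- A x ^ 2)))] everywhere. Integrating,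
    the integral of [t ^ q] is at most [m / n] plus the integral over the line of
    [phi (exp (- A x ^ 2))] and of a correction supported on
    [A x ^ 2 >= ln 9], whose integral an elementary majorant bounds by a constant
    times [1 / sqrt A]. Since [1 / n < 1 / sqrt (n ^ 2 - 1)], what remains is an
    inequality in [q] alone, with equality at [q = 1]; it follows from
    [exp u >= 1 + u] and rational bounds on [pi] and [ln 3]. *)

Import Order.TTheory GRing.Theory Num.Theory.
Import numFieldNormedType.Exports.
Local Open Scope classical_set_scope.
Local Open Scope ring_scope.

Set Implicit Arguments.
Unset Strict Implicit.

(** * Derivatives of real functions, and monotonicity from the sign of the derivative *)

Section Derivatives.
Variable R : realType.
Implicit Types (f g : R -> R) (x a b c : R).

(* A plain definition rather than the class [is_derive]: instance search
   would otherwise guess derivatives in an unwanted syntactic form. *)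
Definition has_deriv f x a := is_derive x 1 f a.

Lemma has_deriv_eq f x a b : has_deriv f x a -> a = b -> has_deriv f x b.
Proof. by move=> ? <-. Qed.

Lemma has_deriv_cst c x : has_deriv (fun=> c) x 0.
Proof. exact: is_derive_cst. Qed.

Lemma has_deriv_id x : has_deriv (fun y => y) x 1.
Proof. exact: is_derive_id. Qed.

Lemma has_derivD f g x a b : has_deriv f x a -> has_deriv g x b ->
  has_deriv (fun y => f y + g y) x (a + b).
Proof. exact: is_deriveD. Qed.

Lemma has_derivN f x a : has_deriv f x a -> has_deriv (fun y => - f y) x (- a).
Proof. exact: is_deriveN. Qed.

Lemma has_derivM f g x a b : has_deriv f x a -> has_deriv g x b ->
  has_deriv (fun y => f y * g y) x (f x * b + g x * a).
Proof. exact: is_deriveM. Qed.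

Lemma has_derivX f n x a : has_deriv f x a ->
  has_deriv (fun y => f y ^+ n) x (n%:R * f x ^+ n.-1 * a).
Proof.
move=> fa; have := @is_deriveX _ _ f n x 1 a fa.
congr (is_derive _ _ _ _); apply/funext => y.
by elim: n => [|n ih]; rewrite ?expr0// !exprS -ih.
Qed.

Lemma has_derivV f x a : f x != 0 -> has_deriv f x a ->
  has_deriv (fun y => (f y)^-1) x (- f x ^- 2 * a).
Proof. exact: is_deriveV. Qed.

Lemma has_deriv_sum n (f : 'I_n -> R -> R) (a : 'I_n -> R) x :
  (forall i, has_deriv (f i) x (a i)) ->
  has_deriv (fun y => \sum_(i < n) f i y) x (\sum_(i < n) a i).
Proof.
move=> fa; have := @is_derive_sum _ _ _ n f x 1 a fa.
by congr (is_derive _ _ _ _); apply/funext => y; rewrite fct_sumE.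
Qed.

Lemma has_deriv_sin f x a : has_deriv f x a ->
  has_deriv (fun y => sin (f y)) x (cos (f x) * a).
Proof. by move=> fa; apply: (is_derive1_comp (f := sin)). Qed.

Lemma has_deriv_cos f x a : has_deriv f x a ->
  has_deriv (fun y => cos (f y)) x (- sin (f x) * a).
Proof. by move=> fa; apply: (is_derive1_comp (f := cos)). Qed.

Lemma has_deriv_expR f x a : has_deriv f x a ->
  has_deriv (fun y => expR (f y)) x (expR (f x) * a).
Proof. by move=> fa; apply: (is_derive1_comp (f := expR)). Qed.

Lemma has_deriv_derivable f x a : has_deriv f x a -> derivable f x 1.
Proof. by case. Qed.

Lemma has_deriv_derive1 f x a : has_deriv f x a -> derive1 f x = a.
Proof. by rewrite derive1E; case. Qed.

Lemma has_deriv_continuous f x a : has_deriv f x a -> {for x, continuous f}.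
Proof.
by move=> /has_deriv_derivable fx; apply/differentiable_continuous/derivable1_diffP.
Qed.

Lemma has_deriv_le f (f' : R -> R) a b :
  (forall x, a <= x <= b -> has_deriv f x (f' x)) ->
  (forall x, a <= x <= b -> 0 <= f' x) -> a <= b -> f a <= f b.
Proof.
move=> df f'0 ab.
have dv x : a <= x <= b -> derivable f x 1.
  by move=> /df; exact: has_deriv_derivable.
apply: (@ger0_derive1_le_cc _ f a b) => //; rewrite ?in_itv/= ?lexx ?ab//.
- by move=> x; rewrite in_itv/= => /andP[/ltW ax /ltW xb]; apply: dv; rewrite ax.
- move=> x; rewrite in_itv/= => /andP[/ltW ax /ltW xb].
  have axb : a <= x <= b by rewrite ax.
  by rewrite (has_deriv_derive1 (df _ axb)) f'0.
- by apply: derivable_within_continuous => x; rewrite in_itv/=; exact: dv.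
Qed.

End Derivatives.

Ltac has_deriv_tac :=
  apply: has_deriv_eq;
  [repeat first
     [ apply: has_deriv_cst | apply: has_deriv_id
     | apply: has_derivD | apply: has_derivN
     | apply: has_derivM | apply: has_derivX
     | apply: has_deriv_sin | apply: has_deriv_cos
     | apply: has_deriv_expR | apply: has_derivV ] | rewrite /= ].

(** * Taylor bounds for sine, cosine and the exponential; rational bounds on [pi] and [ln 3] *)

Section Trigonometry.
Variable R : realType.
Implicit Types x : R.

(** First of a chain that starts from [cos <= 1]: each difference vanishes at 0, and its derivative
    is the difference treated just before. *)
Lemma sin_le_id x : 0 <= x -> sin x <= x.
Proof.
move=> x0; rewrite -subr_ge0.
have df (y : R) : has_deriv (fun y => y - sin y) y
  (1 - cos y).
  by has_deriv_tac; ring.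
have /= := has_deriv_le (fun y _ => df y) _ x0;
rewrite sin0 subrr; apply.
by move=> y /andP[y0 _]; rewrite subr_ge0 cos_le1.
Qed.

Lemma cos_ge_taylor2 x : 0 <= x -> 1 - x ^+ 2 / 2 <= cos x.
Proof.
move=> x0; rewrite -subr_ge0.
have df (y : R) : has_deriv (fun y => cos y - (1 - y ^+ 2 / 2)) y
  (y - sin y).
  by has_deriv_tac; field.
have /= := has_deriv_le (fun y _ => df y) _ x0;
rewrite cos0 expr0n/= mul0r subr0 subrr; apply.
by move=> y /andP[y0 _]; rewrite subr_ge0 sin_le_id.
Qed.

Lemma sin_ge_taylor3 x : 0 <= x -> x - x ^+ 3 / 6 <= sin x.
Proof.
move=> x0; rewrite -subr_ge0.
have df (y : R) : has_deriv (fun y => sin y - (y - y ^+ 3 / 6)) y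
  (cos y - (1 - y ^+ 2 / 2)).
  by has_deriv_tac; field.
have /= := has_deriv_le (fun y _ => df y) _ x0;
rewrite sin0 expr0n/= mul0r subr0 subrr; apply.
by move=> y /andP[y0 _]; rewrite subr_ge0 cos_ge_taylor2.
Qed.

Lemma cos_le_taylor4 x : 0 <= x -> cos x <= 1 - x ^+ 2 / 2 + x ^+ 4 / 24.
Proof.
move=> x0; rewrite -subr_ge0.
have df (y : R) : has_deriv (fun y => 1 - y ^+ 2 / 2 + y ^+ 4 / 24 - cos y) y
  (sin y - (y - y ^+ 3 / 6)).
  by has_deriv_tac; field.
have /= := has_deriv_le (fun y _ => df y) _ x0;
rewrite cos0 !expr0n/= !mul0r subr0 addr0 subrr; apply.
by move=> y /andP[y0 _]; rewrite subr_ge0 sin_ge_taylor3.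
Qed.

Lemma sin_le_taylor5 x : 0 <= x -> sin x <= x - x ^+ 3 / 6 + x ^+ 5 / 120.
Proof.
move=> x0; rewrite -subr_ge0.
have df (y : R) : has_deriv (fun y => y - y ^+ 3 / 6 + y ^+ 5 / 120 - sin y) y
  (1 - y ^+ 2 / 2 + y ^+ 4 / 24 - cos y).
  by has_deriv_tac; field.
have /= := has_deriv_le (fun y _ => df y) _ x0;
rewrite sin0 !expr0n/= !mul0r subr0 addr0 subrr; apply.
by move=> y /andP[y0 _]; rewrite subr_ge0 cos_le_taylor4.
Qed.

Lemma cos_ge_taylor6 x : 0 <= x ->
  1 - x ^+ 2 / 2 + x ^+ 4 / 24 - x ^+ 6 / 720 <= cos x.
Proof.
move=> x0; rewrite -subr_ge0.
have df (y : R) : has_deriv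
  (fun y => cos y - (1 - y ^+ 2 / 2 + y ^+ 4 / 24 - y ^+ 6 / 720)) y
  (y - y ^+ 3 / 6 + y ^+ 5 / 120 - sin y).
  by has_deriv_tac; field.
have /= := has_deriv_le (fun y _ => df y) _ x0;
rewrite cos0 !expr0n/= !mul0r !subr0 addr0 subrr; apply.
by move=> y /andP[y0 _]; rewrite subr_ge0 sin_le_taylor5.
Qed.

(** Otherwise cosine would be at most 0 at [91 / 58], where its sixth-order Taylor lower bound is
    still positive. *)
Lemma pi_gt_91_29 : (91 / 29 : R) < pi.
Proof.
rewrite ltNge; apply/negP => pile.
have [pi0 pi2] := (pi_gt0 R, pi_ge2 R).
have h0 : (0 : R) <= 91 / 58 by lra.
have := cos_ge_taylor6 h0.
have : cos (91 / 58 : R) <= cos (pi / 2).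
  have [->//|ne] := eqVneq (91 / 58 : R) (pi / 2).
  apply/ltW; rewrite ltr_cos ?in_itv/=; try by apply/andP; split; lra.
  by rewrite lt_neqAle eq_sym ne/=; lra.
rewrite cos_pihalf => c0 /le_trans /(_ c0); rewrite leNgt => /negP; apply; lra.
Qed.

(** The Padé bound [exp y <= (2 + y) / (2 - y)] at [y = 109 / 400] gives [909 / 691], whose fourth
    power is below 3. *)
Lemma ln3_ge : (109 / 100 : R) <= ln 3.
Proof.
rewrite -ler_expR lnK ?posrE; last by lra.
have h (y : R) : 0 <= y <= 1 -> (2 - y) * expR y <= 2 + y.
  move=> /andP[y0 y1]; rewrite -subr_ge0.
  have -> : (0 : R) = 2 + 0 - (2 - 0) * expR 0 by rewrite expR0; ring.
  have df (z : R) : has_deriv (fun z => 2 + z - (2 - z) * expR z) z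
    (1 - (1 - z) * expR z).
    by has_deriv_tac; ring.
  have /= := has_deriv_le (fun z _ => df z) _ y0; apply=> z /andP[z0 zy].
  have := expR_ge1Dx (- z); rewrite expRN => h1.
  rewrite subr_ge0 -ler_pdivlMr ?expR_gt0// mul1r; lra.
have h2 : 0 <= (109 / 400 : R) <= 1 by lra.
have := h _ h2.
have -> : (109 / 100 : R) = 4 * (109 / 400) by field.
rewrite (expRM_natl 4); have e0 := expR_ge0 (109 / 400 : R).
move: (expR _) e0 => e e0 he.
have he1 : e <= 909 / 691 by lra.
apply: (@le_trans _ _ ((909 / 691) ^+ 4)); last by lra.
by rewrite lerXn2r// nnegrE; lra.
Qed.

Lemma expR_ge_taylor2 x : 0 <= x -> 1 + x + x ^+ 2 / 2 <= expR x.
Proof.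
move=> x0; rewrite -subr_ge0.
have df (y : R) : has_deriv (fun y => expR y - (1 + y + y ^+ 2 / 2)) y
  (expR y - (1 + y)).
  by has_deriv_tac; field.
have /= := has_deriv_le (fun y _ => df y) _ x0;
rewrite expR0 expr0n/= mul0r !addr0 subrr; apply.
by move=> y /andP[y0 _]; rewrite subr_ge0 expR_ge1Dx.
Qed.

Lemma expR_ge_taylor3 x : 0 <= x -> 1 + x + x ^+ 2 / 2 + x ^+ 3 / 6 <= expR x.
Proof.
move=> x0; rewrite -subr_ge0.
have df (y : R) : has_deriv
  (fun y => expR y - (1 + y + y ^+ 2 / 2 + y ^+ 3 / 6)) y
  (expR y - (1 + y + y ^+ 2 / 2)).
  by has_deriv_tac; field.
have /= := has_deriv_le (fun y _ => df y) _ x0;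
rewrite expR0 !expr0n/= !mul0r !addr0 subrr; apply.
by move=> y /andP[y0 _]; rewrite subr_ge0 expR_ge_taylor2.
Qed.

(** The cube of the third-order Taylor bound at [37 / 100] already exceeds 3. *)
Lemma ln3_le : ln 3 <= (111 / 100 : R).
Proof.
rewrite -ler_expR lnK ?posrE; last by lra.
have -> : (111 / 100 : R) = 3 * (37 / 100) by field.
rewrite (expRM_natl 3).
have h : (0 : R) <= 37 / 100 by lra.
apply: le_trans (lerXn2r 3 _ _ (expR_ge_taylor3 h)); rewrite ?nnegrE ?expR_ge0//; lra.
Qed.

End Trigonometry.

(** * Bounds on [sin (n u)] against [n sin u], on the main lobe and on the side lobes *)

Section SineBounds.
Variable R : realType.
Implicit Types (x y u v w t : R) (n : nat).

Lemma sinB_id_cos_ge0 y : 0 <= y <= pi -> 0 <= sin y - y * cos y.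
Proof.
move=> /andP[y0 ypi].
have df z : has_deriv (fun z : R => sin z - z * cos z) z (z * sin z).
  by has_deriv_tac; ring.
have /= := has_deriv_le (fun z _ => df z) _ y0.
rewrite sin0 mul0r subrr; apply=> z /andP[z0 zy].
by rewrite mulr_ge0// sin_ge0_pi// z0 (le_trans zy).
Qed.

(** Up to the factor [exp (y ^ 2 / 6) / y ^ 2], this is minus the derivative of
    [sin y / y * exp (y ^ 2 / 6)]. Its own derivative is [y / 3] times the previous expression. *)
Lemma sinB_id_cos_sqr_ge0 y : 0 <= y <= pi ->
  0 <= sin y - y * cos y - y ^+ 2 * sin y / 3.
Proof.
move=> /andP[y0 ypi].
have df z : has_deriv (fun z : R => sin z - z * cos z - z ^+ 2 * sin z / 3) z
    (z / 3 * (sin z - z * cos z)).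
  by has_deriv_tac; field.
have /= := has_deriv_le (fun z _ => df z) _ y0.
rewrite sin0 expr0n/= !mul0r !subrr; apply=> z /andP[z0 zy].
by rewrite mulr_ge0 ?divr_ge0// sinB_id_cos_ge0// z0 (le_trans zy).
Qed.

Lemma sinc_expR_decr u v : 0 < u -> u <= v -> v <= pi ->
  sin v / v * expR (v ^+ 2 / 6) <= sin u / u * expR (u ^+ 2 / 6).
Proof.
move=> u0 uv vpi; rewrite -lerN2.
have df z : u <= z <= v ->
  has_deriv (fun z : R => - (sin z / z * expR (z ^+ 2 / 6))) z
    ((sin z - z * cos z - z ^+ 2 * sin z / 3) / z ^+ 2 * expR (z ^+ 2 / 6)).
  move=> /andP[uz _]; have z0 : z != 0 by rewrite gt_eqF// (lt_le_trans u0).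
  by has_deriv_tac => //; field.
apply: has_deriv_le df _ uv => z /andP[uz zv].
rewrite mulr_ge0 ?expR_ge0// divr_ge0 ?sqr_ge0// sinB_id_cos_sqr_ge0//.
by rewrite (le_trans (ltW u0) uz) (le_trans zv).
Qed.

(** Compares the decreasing function of [sinc_expR_decr] at [u] and at [n * u]. *)
Lemma sin_mul_main_lobe n u : (0 < n)%N -> 0 < u -> n%:R * u <= pi ->
  sin (n%:R * u) <= n%:R * sin u * expR (- ((n%:R ^+ 2 - 1) * u ^+ 2 / 6)).
Proof.
move=> n0 u0 nupi.
have n0' : (0 : R) < n%:R by rewrite ltr0n.
have n1 : (1 : R) <= n%:R by rewrite ler1n.
have := sinc_expR_decr u0 (ler_peMl (ltW u0) n1) nupi.
rewrite (_ : (n%:R ^+ 2 - 1) * u ^+ 2 / 6 =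
  (n%:R * u) ^+ 2 / 6 - u ^+ 2 / 6); last by field.
rewrite opprB expRB -ler_pdivlMr ?expR_gt0// => h.
have nu0 : 0 < (n%:R * u)^-1 by rewrite invr_gt0 mulr_gt0.
rewrite -(ler_pM2r nu0); apply: (le_trans h).
rewrite le_eqVlt; apply/orP; left; apply/eqP; field.
by rewrite !gt_eqF ?expR_gt0.
Qed.

(** Concavity of sine along the chord from the origin; the derivative in [w] is
    [t * (cos (t w) - cos w)]. *)
Lemma ler_mul_sin t w : 0 <= t <= 1 -> 0 <= w <= pi -> t * sin w <= sin (t * w).
Proof.
move=> /andP[t0 t1] /andP[w0 wpi]; rewrite -subr_ge0.
have df z : has_deriv (fun z : R => sin (t * z) - t * sin z) z
    (t * (cos (t * z) - cos z)).
  by has_deriv_tac; ring.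
have /= := has_deriv_le (fun z _ => df z) _ w0.
rewrite mulr0 sin0 mulr0 subrr; apply=> z /andP[z0 zw].
rewrite mulr_ge0// subr_ge0.
have zpi : z <= pi by exact: le_trans wpi.
have tz : t * z <= z by rewrite ler_piMl.
have [->//|ne] := eqVneq (t * z) z.
apply/ltW; rewrite ltr_cos ?in_itv/= ?z0 ?zpi ?mulr_ge0 ?(le_trans tz)//.
by rewrite lt_neqAle ne.
Qed.

Lemma sin_mul3 w : sin (3 * w) = sin w * (3 - 4 * sin w ^+ 2).
Proof.
rewrite (_ : 3 * w = w + w + w); last by ring.
by rewrite !sinD cosD; have := cos2sin2 w => h; ring: h.
Qed.

Lemma sin_pi3_sqr : sin (pi / 3) ^+ 2 = 3 / 4 :> R.
Proof.
have p0 := pi_gt0 R.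
have : sin (3 * (pi / 3)) = 0 :> R.
  by rewrite (_ : 3 * (pi / 3) = pi) ?sinpi//; field.
rewrite sin_mul3 => /eqP; rewrite mulf_eq0 => /orP[/eqP s0|/eqP]; last by lra.
by have : 0 < sin (pi / 3) :> R; [rewrite sin_gt0_pi//; lra|rewrite s0 ltxx].
Qed.

(** On this range [sin w ^ 2] lies between [3 / 4] and 1, so the factor [3 - 4 * sin w ^ 2] of the
    triple-angle formula lies in [[-1, 0]]. *)
Lemma norm_sin_mul3_le w : pi / 3 <= w <= pi / 2 -> `|sin (3 * w)| <= sin w.
Proof.
move=> /andP[w3 w2]; have p0 := pi_gt0 R.
have s0 : 0 <= sin w by rewrite sin_ge0_pi//; lra.
have s30 : 0 <= sin (pi / 3) :> R by rewrite sin_ge0_pi//; lra.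
have : sin (pi / 3) <= sin w.
  have [->//|ne] := eqVneq (pi / 3) w.
  apply/ltW; rewrite ltr_sin ?in_itv/=; first by rewrite lt_neqAle ne.
    by lra.
  by lra.
move=> sw; have := sin_pi3_sqr.
have : sin (pi / 3) ^+ 2 <= sin w ^+ 2 by rewrite ler_sqr ?nnegrE.
have := sin2cos2 w; have := sqr_ge0 (cos w) => c0 sc sl se.
rewrite sin_mul3 normrM (ger0_norm s0) ler_piMr// ler_norml; lra.
Qed.

(** Beyond [3 pi / 2], Jordan's inequality [sin u >= 2 u / pi] makes the right-hand side at least 1.
    Before that, for [n >= 3], the triple-angle bound at [w = n u / 3] leaves [sin w], which is at
    most [n / 3 * sin u] by concavity with ratio [3 / n]. *)
Lemma norm_sin_mul_side_lobes n u : (2 <= n)%N -> pi <= n%:R * u -> u <= pi / 2 ->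
  `|sin (n%:R * u)| <= n%:R * sin u / 3.
Proof.
move=> n2 nu u2; have p0 := pi_gt0 R.
have n0 : (0 : R) < n%:R by rewrite ltr0n (ltn_trans _ n2).
have u0 : 0 < u by rewrite -(pmulr_rgt0 _ n0) (lt_le_trans p0).
have [nu32|nu32] := leP (n%:R * u) (3 * (pi / 2)); last first.
  have : 2 / pi * u * sin (pi / 2) <= sin (2 / pi * u * (pi / 2)).
    apply: ler_mul_sin; last by lra.
    apply/andP; split; first by rewrite ltW// !mulr_gt0 ?invr_gt0.
    by rewrite mulrAC ler_pdivrMr// mul1r; lra.
  rewrite sin_pihalf mulr1 (_ : 2 / pi * u * (pi / 2) = u); last first.
    by move: (pi : R) p0 => q q0; field; rewrite gt_eqF.
  move=> h; apply: (le_trans (sin_max _)).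
  have : n%:R * (2 / pi * u) <= n%:R * sin u by rewrite ler_pM2l.
  rewrite (_ : n%:R * (2 / pi * u) = 2 / pi * (n%:R * u)); last by ring.
  have : 3 <= 2 / pi * (n%:R * u).
    by rewrite mulrAC ler_pdivlMr//; lra.
  by lra.
have := n2; rewrite leq_eqVlt => /orP[/eqP n2'|n3].
  (* For [n = 2] the side lobe reduces to the endpoint [u = pi / 2], where [sin (2 u)] vanishes. *)
  move: nu u2; rewrite -n2' => nu u2.
  have -> : u = pi / 2 by lra.
  by rewrite mulrC divfK// sinpi normr0 sin_pihalf; lra.
have n3' : (3 : R) <= n%:R by rewrite ler_nat.
have h1 : `|sin (n%:R * u)| <= sin (n%:R * u / 3).
  have := @norm_sin_mul3_le (n%:R * u / 3).
  by rewrite [3 * _]mulrC divfK//; apply; lra.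
apply: (le_trans h1).
have : 3 / n%:R * sin (n%:R * u / 3) <= sin (3 / n%:R * (n%:R * u / 3)).
  apply: ler_mul_sin; last by lra.
  by apply/andP; split; [exact/ltW/divr_gt0 | rewrite ler_pdivrMr// mul1r].
have -> : 3 / n%:R * (n%:R * u / 3) = u by field; rewrite gt_eqF.
rewrite -(ler_pM2l n0); move: (sin (_ / 3)) => z.
by have -> : n%:R * (3 / n%:R * z) = 3 * z; [field; rewrite gt_eqF | lra].
Qed.

End SineBounds.

(** * Dirichlet and Fejer kernels *)

Section Fejer.
Variable R : realType.
Implicit Types (x u : R) (n : nat).

(** The Dirichlet kernel of order [n] at the angle [2 * u], in real form. *)
Definition dirichlet n u : R := 1 + \sum_(k < n) 2 * cos (k.+1%:R * 2 * u).

(** The Fejer kernel without its normalising factor [1 / n]. *)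
Definition fejer n u : R := \sum_(j < n) dirichlet j u.

(** Telescoping, since [2 sin u cos (2 k u) = sin ((2 k + 1) u) - sin ((2 k - 1) u)]. *)
Lemma sin_mul_dirichlet n u : sin u * dirichlet n u = sin ((n%:R * 2 + 1) * u).
Proof.
elim: n => [|n ih]; first by rewrite /dirichlet big_ord0 mul0r add0r mul1r addr0 mulr1.
rewrite /dirichlet big_ord_recr/= addrA mulrDr -/(dirichlet n u) ih.
rewrite (_ : (n%:R * 2 + 1) * u = n.+1%:R * 2 * u - u); last by rewrite -natr1; ring.
rewrite (_ : (n.+1%:R * 2 + 1) * u = n.+1%:R * 2 * u + u); last by ring.
by rewrite sinB sinD; ring.
Qed.

(** Telescoping again: [sin u sin ((2 n + 1) u) = sin ((n + 1) u) ^ 2 - sin (n u) ^ 2]. *)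
Lemma sin_sqr_mul_fejer n u : sin u ^+ 2 * fejer n u = sin (n%:R * u) ^+ 2.
Proof.
elim: n => [|n ih]; first by rewrite /fejer big_ord0 mulr0 mul0r sin0 expr0n.
rewrite /fejer big_ord_recr/= mulrDr -/(fejer n u) ih expr2 -mulrA sin_mul_dirichlet.
rewrite (_ : (n%:R * 2 + 1) * u = n.+1%:R * u + n%:R * u); last by rewrite -natr1; ring.
have -> : sin u = sin (n.+1%:R * u - n%:R * u) by congr sin; rewrite -natr1; ring.
rewrite sinB sinD; move: (cos2sin2 (n.+1%:R * u)) (cos2sin2 (n%:R * u)) => h1 h2.
by ring: h1 h2.
Qed.

(** The previous identity is void at 0; there the kernel is the sum of the first [n] odd numbers. *)
Lemma fejer0 n : fejer n 0 = n%:R ^+ 2 :> R.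
Proof.
rewrite /fejer (eq_bigr (fun j : 'I_n => 1 + j%:R * 2)); last first.
  move=> j _; rewrite /dirichlet; under eq_bigr do rewrite mulr0 cos0 mulr1.
  by rewrite sumr_const card_ord mulr_natl.
elim: n => [|n ih]; first by rewrite big_ord0 expr0n.
by rewrite big_ord_recr/= ih -natr1; ring.
Qed.

Lemma fejerN n u : fejer n (- u) = fejer n u.
Proof.
apply: eq_bigr => j _; congr (1 + _); apply: eq_bigr => k _.
by rewrite mulrN cosN.
Qed.

End Fejer.

(** * Pointwise bound on powers of the squared sine ratio *)

Section PointwiseBound.
Variable R : realType.
Implicit Types (x p t q Y M : R) (n : nat).

(** The squared sine ratio as a trigonometric polynomial, hence continuous and equal to 1 at 0
    without a case split. *)
Definition fejer_mean n x : R := fejer n (pi * x) / n%:R ^+ 2.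

Lemma sin_pi_gt0 x : 0 < x <= 2^-1 -> 0 < sin (pi * x).
Proof.
move=> /andP[x0 x2]; have p0 := pi_gt0 R.
rewrite sin_gt0_pi// mulr_gt0//= gtr_pMr//.
by apply: le_lt_trans x2 _; lra.
Qed.

Lemma fejer_mean_gt0E n x : (0 < n)%N -> 0 < x <= 2^-1 ->
  fejer_mean n x = (sin (n%:R * (pi * x)) / (n%:R * sin (pi * x))) ^+ 2.
Proof.
move=> n0 /sin_pi_gt0 s0; have n0' : (0 : R) < n%:R by rewrite ltr0n.
rewrite /fejer_mean exprMn -sin_sqr_mul_fejer; move: (fejer _ _) => F.
by field; rewrite !gt_eqF.
Qed.

Lemma fejer_meanN n x : fejer_mean n (- x) = fejer_mean n x.
Proof. by rewrite /fejer_mean mulrN fejerN. Qed.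

Lemma fejer_mean0 n : (0 < n)%N -> fejer_mean n 0 = 1.
Proof.
by move=> n0; rewrite /fejer_mean mulr0 fejer0 divff// expf_neq0// pnatr_eq0 -lt0n.
Qed.

Lemma fejer_mean_absE n x : fejer_mean n `|x| = fejer_mean n x.
Proof. by case: (ger0P x); rewrite ?fejer_meanN. Qed.

Lemma fejer_mean_ge0 n x : (0 < n)%N -> `|x| <= 2^-1 -> 0 <= fejer_mean n x.
Proof.
move=> n0 x2; rewrite -fejer_mean_absE.
have [->|x0] := eqVneq x 0; first by rewrite normr0 fejer_mean0.
by rewrite fejer_mean_gt0E ?sqr_ge0// normr_gt0 x0.
Qed.

(** Both sides are 1 at 0; elsewhere the power [p] of an absolute value is the power [p / 2] of the
    square, and evenness covers negative [x]. *)
Lemma sine_ratio_powE n p x : (0 < n)%N -> `|x| <= 2^-1 ->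
  sine_ratio_pow n p x = fejer_mean n x `^ (p / 2).
Proof.
move=> n0 x2; rewrite /sine_ratio_pow -fejer_mean_absE.
have [->|x0] := eqVneq x 0; first by rewrite normr0 fejer_mean0// powR1.
rewrite fejer_mean_gt0E ?normr_gt0 ?x0// -real_normK ?num_real//.
rewrite -powR_mulrn// -powRrM (_ : 2%:R * (p / 2) = p); last by field.
rewrite -[n%:R * pi * x]mulrA.
by case: (ger0P x) => // _; rewrite !mulrN !sinN mulrN invrN mulrNN.
Qed.

Lemma fejer_mean_main_lobe n x : (0 < n)%N -> `|x| <= n%:R^-1 -> `|x| <= 2^-1 ->
  fejer_mean n x <= expR (- ((n%:R ^+ 2 - 1) * pi ^+ 2 / 3 * x ^+ 2)).
Proof.
move=> n0 xn x2; rewrite -fejer_mean_absE -(real_normK (num_real x)).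
have n0' : (0 : R) < n%:R by rewrite ltr0n.
have p0 := pi_gt0 R.
have [->|x0] := eqVneq x 0.
  by rewrite normr0 fejer_mean0// expr0n/= mulr0 oppr0 expR0.
have {x0} : 0 < `|x| by rewrite normr_gt0.
move: `|x| xn x2 => {x} x xn x2 x0.
have s0 : 0 < sin (pi * x) by rewrite sin_pi_gt0// x0.
have u0 : 0 < pi * x by rewrite mulr_gt0.
have nu : n%:R * (pi * x) <= pi.
  by rewrite mulrCA ger_pMr// -ler_pdivlMl// mulr1.
have h := sin_mul_main_lobe n0 u0 nu.
rewrite fejer_mean_gt0E ?x0//.
have -> : - ((n%:R ^+ 2 - 1) * pi ^+ 2 / 3 * x ^+ 2) =
    2%:R * - ((n%:R ^+ 2 - 1) * (pi * x) ^+ 2 / 6) :> R.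
  by move: (pi : R) => q; field.
rewrite expRM_natl; apply: lerXn2r; rewrite ?nnegrE ?expR_ge0//.
  by rewrite divr_ge0 ?sin_ge0_pi ?mulr_ge0// ?ltW ?mulr_gt0.
by rewrite ler_pdivrMr ?mulr_gt0// [leRHS]mulrC.
Qed.

Lemma fejer_mean_side_lobes n x : (2 <= n)%N -> n%:R^-1 <= `|x| -> `|x| <= 2^-1 ->
  fejer_mean n x <= 9^-1.
Proof.
move=> n2 xn x2; rewrite -fejer_mean_absE.
have n0 : (0 < n)%N by exact: ltn_trans n2.
have n0' : (0 : R) < n%:R by rewrite ltr0n.
have p0 := pi_gt0 R.
have x0 : 0 < `|x| by rewrite (lt_le_trans _ xn)// invr_gt0.
move: `|x| x0 xn x2 => {}x x0 xn x2.
have s0 : 0 < sin (pi * x) by rewrite sin_pi_gt0// x0.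
have nu : pi <= n%:R * (pi * x).
  by rewrite mulrCA ler_pMr// -ler_pdivrMl// mulr1.
have u2 : pi * x <= pi / 2 by rewrite ler_pM2l.
have h := norm_sin_mul_side_lobes n2 nu u2.
rewrite fejer_mean_gt0E ?x0// -real_normK ?num_real//.
rewrite (_ : 9^-1 = 3^-1 ^+ 2 :> R); last by field.
apply: lerXn2r; rewrite ?nnegrE ?invr_ge0//.
rewrite normrM normfV (ger0_norm (ltW (mulr_gt0 n0' s0))).
by rewrite ler_pdivrMr ?mulr_gt0// [leRHS]mulrC.
Qed.

(** With [m = exp (- (q - 1) M)], the first line is [phi (exp (- Y))], which is negative for [Y > M]
    when [q > 1]; the second line compensates for this. It is used at [Y = A x ^ 2]. *)
Definition gauss_defect q M Y : R :=
  expR (- (q * Y)) - expR (- ((q - 1) * M)) * expR (- Y)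
  + expR (- ((q - 1) * M)) * (q - 1) * (Num.max 0 (Y - M) * expR (- Y)).

(** After factoring out [m * exp (- Y)], it remains that [exp (- s) - 1 + max 0 s >= 0] for
    [s = (q - 1) (Y - M)]. *)
Lemma gauss_defect_ge0 q M Y : 1 <= q -> 0 <= gauss_defect q M Y.
Proof.
move=> q1; rewrite /gauss_defect.
have -> : expR (- (q * Y)) =
    expR (- ((q - 1) * M)) * expR (- ((q - 1) * (Y - M))) * expR (- Y).
  by rewrite -!expRD; congr expR; ring.
have := expR_ge0 (- ((q - 1) * M)); have := expR_ge0 (- Y).
have := expR_ge1Dx (- ((q - 1) * (Y - M))).
have : Y <= M -> 1 <= expR (- ((q - 1) * (Y - M))).
  move=> YM; rewrite -[leLHS]expR0 ler_expR oppr_ge0.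
  by rewrite mulr_ge0_le0 ?subr_ge0 ?subr_le0.
move: (expR _) (expR (- Y)) (expR (- (_ * M))) => e y m h1 h2 y0 m0.
rewrite (_ : _ + _ = m * y * (e - 1 + (q - 1) * Num.max 0 (Y - M))); last by ring.
rewrite mulr_ge0 ?mulr_ge0//.
case: (leP (Y - M) 0); first by rewrite subr_le0 => /h1; lra.
by lra.
Qed.

(* The function [t `^ q - m * t], with [m = expR (- (q - 1) M)], is negative
   below [expR (- M)] and increasing above it. *)
Lemma powR_le_gauss_defect q M Y t : 1 <= q -> 0 <= t ->
  t <= expR (- M) \/ t <= expR (- Y) ->
  t `^ q <= expR (- ((q - 1) * M)) * t + gauss_defect q M Y.
Proof.
move=> q1 t0 tMY; have D0 := gauss_defect_ge0 M Y q1.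
have r0 : 0 <= q - 1 by rewrite subr_ge0.
have eM Z : expR (- ((q - 1) * Z)) = expR (- Z) `^ (q - 1).
  by rewrite -expRM; congr expR; ring.
rewrite -mulr_powRB1//; last by lra.
have [tM|Mt] := leP t (expR (- M)).
  rewrite ler_wpDr// mulrC ler_wpM2r// eM.
  by rewrite ge0_ler_powR// nnegrE ?expR_ge0.
have tY : t <= expR (- Y) by case: tMY => //; rewrite leNgt Mt.
have h1 : expR (- ((q - 1) * M)) <= t `^ (q - 1).
  by rewrite eM ge0_ler_powR// ?nnegrE ?expR_ge0// ltW.
have h2 : t `^ (q - 1) <= expR (- ((q - 1) * Y)).
  by rewrite eM ge0_ler_powR// ?nnegrE ?expR_ge0.
rewrite /gauss_defect.
have -> : expR (- (q * Y)) = expR (- ((q - 1) * Y)) * expR (- Y).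
  by rewrite -!expRD; congr expR; ring.
have : 0 <= expR (- ((q - 1) * M)) * (q - 1) * (Num.max 0 (Y - M) * expR (- Y)).
  by rewrite !mulr_ge0 ?expR_ge0// le_max lexx.
move: (expR (- ((q - 1) * M))) (expR (- ((q - 1) * Y))) (expR (- Y)) (t `^ _)
  (Num.max _ _) h1 h2 tY => m y e s mx h1 h2 tY h3.
(* Above [exp (- M)] both factors of [t * (t ^ (q - 1) - m)] are nonnegative, and each is bounded by
   its value at [exp (- Y)]. *)
have : t * (s - m) <= e * (y - m) by apply: ler_pM => //; lra.
lra.
Qed.

End PointwiseBound.

(** * Integrals of the Fejer kernel and of Gaussians *)

Section Integrals.
Variable R : realType.
Implicit Types (x c q M : R) (n : nat).
Local Notation mu := (@lebesgue_measure R).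

Lemma sin_pi_mul_nat n : sin (pi * n%:R) = 0 :> R.
Proof.
elim: n => [|n ih]; first by rewrite mulr0 sin0.
by rewrite -natr1 mulrDr mulr1 sinDpi ih oppr0.
Qed.

Lemma has_deriv_continuous_all (f f' : R -> R) :
  (forall x, has_deriv f x (f' x)) -> continuous f.
Proof. by move=> df x; exact: has_deriv_continuous (df x). Qed.

Lemma has_deriv_dirichlet n x :
  has_deriv (fun x : R =>
      x + \sum_(k < n) sin (k.+1%:R * 2 * (pi * x)) / (k.+1%:R * pi))
    x (dirichlet n (pi * x)).
Proof.
apply: has_derivD; first exact: has_deriv_id.
apply: has_deriv_sum => k; have p0 := pi_gt0 R.
have k0 : (0 : R) < k.+1%:R by rewrite ltr0n.
move: (pi : R) p0 => q q0; has_deriv_tac.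
by field; rewrite !gt_eqF.
Qed.

Lemma continuous_fejer_mean n : continuous (@fejer_mean R n).
Proof.
have dD j x : has_deriv (fun x : R => dirichlet j (pi * x)) x
    (0 + \sum_(k < j) - (2 * (k.+1%:R * 2 * pi) * sin (k.+1%:R * 2 * (pi * x)))).
  apply: has_derivD; first exact: has_deriv_cst.
  apply: has_deriv_sum => k; move: (pi : R) => q; has_deriv_tac.
  by ring.
move=> x; apply: has_deriv_continuous.
apply: has_derivM; last exact: has_deriv_cst.
by apply: has_deriv_sum => j; exact: dD.
Qed.

(** In the primitive [F], every sine is taken at a multiple of [pi] when [x] is [1 / 2] or
    [- 1 / 2], so only the [n] linear terms contribute. *)
Lemma integral_fejer_mean n : (0 < n)%N ->
  (\int[mu]_(x in `[(- 2^-1)%R, 2^-1%R]) (fejer_mean n x)%:E = (n%:R^-1)%:E)%E.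
Proof.
move=> n0; have n0' : (0 : R) < n%:R by rewrite ltr0n.
pose F x : R := (\sum_(j < n) (x + \sum_(k < j) sin (k.+1%:R * 2 * (pi * x)) /
  (k.+1%:R * pi))) * (n%:R ^+ 2)^-1.
have dF x : has_deriv F x (fejer_mean n x).
  apply: has_deriv_eq.
    apply: has_derivM; last exact: has_deriv_cst.
    by apply: has_deriv_sum => j; exact: has_deriv_dirichlet.
  by rewrite /= mulr0 add0r mulrC.
have cF := has_deriv_continuous_all dF.
rewrite (@continuous_FTC2 _ _ F).
- have Fh (s : R) : s = 2^-1 \/ s = - 2^-1 -> F s = s / n%:R.
    move=> hs; rewrite /F (eq_bigr (fun=> s)).
      by rewrite sumr_const card_ord -mulr_natr; field; rewrite gt_eqF.
    move=> j _; rewrite big1 ?addr0// => k _.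
    case: hs => ->; rewrite ?mulrN ?sinN.
      rewrite (_ : _ * (pi / 2) = pi * k.+1%:R) ?sin_pi_mul_nat ?mul0r//.
      by rewrite mulrCA mulrA; field.
    rewrite (_ : _ * (pi / 2) = pi * k.+1%:R) ?sin_pi_mul_nat ?oppr0 ?mul0r//.
    by rewrite mulrCA mulrA; field.
  rewrite !Fh; [|by right|by left].
  by rewrite -EFinB; congr EFin; field; rewrite gt_eqF.
- lra.
- by apply: continuous_subspaceT; exact: continuous_fejer_mean.
- split.
  + by move=> x _; exact: has_deriv_derivable (dF x).
  + by apply: cvg_at_right_filter; exact: cF.
  + by apply: cvg_at_left_filter; exact: cF.
- by move=> x _; exact: has_deriv_derive1 (dF x).
Qed.

Lemma continuous_measurable_EFin (f : R -> R) (D : set R) : continuous f ->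
  measurable_fun D (EFin \o f).
Proof.
move=> cf; apply/measurable_EFinP; apply: measurable_funTS.
exact: continuous_measurable_fun.
Qed.

Lemma has_deriv_expR_sqr c x :
  has_deriv (fun x : R => expR (- (c * x ^+ 2))) x
    (- (c * (2 * x)) * expR (- (c * x ^+ 2))).
Proof. by has_deriv_tac; ring. Qed.

Lemma continuous_expR_sqr c : continuous (fun x : R => expR (- (c * x ^+ 2))).
Proof. exact: has_deriv_continuous_all (has_deriv_expR_sqr c). Qed.

Lemma integral_expR_sqr c : 0 < c ->
  (\int[mu]_x (expR (- (c * x ^+ 2)))%:E = (Num.sqrt (pi / c))%:E)%E.
Proof.
(* The Gaussian is a multiple of the normal density of variance [1 / (2 c)], whose integral is 1. *)
move=> c0; pose s : R := Num.sqrt ((2 * c)^-1).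
have s0 : s != 0 by rewrite gt_eqF// sqrtr_gt0 invr_gt0 mulr_gt0.
have sE : s ^+ 2 = (2 * c)^-1 by rewrite sqr_sqrtr// invr_ge0 mulr_ge0// ltW.
have nE x : normal_fun 0 s x = expR (- (c * x ^+ 2)).
  rewrite /normal_fun subr0 sE; congr expR.
  by rewrite -mulr_natr; field; rewrite gt_eqF.
have := integral_normal_pdf (0 : R) s.
under eq_integral do rewrite normal_pdfE// EFinM nE.
rewrite ge0_integralZl_EFin//=.
- have -> : normal_peak s = (Num.sqrt (pi / c))^-1.
    rewrite /normal_peak sE; congr (Num.sqrt _)^-1.
    by rewrite -mulr_natr; field; rewrite gt_eqF.
  have S0 : 0 < Num.sqrt (pi / c) by rewrite sqrtr_gt0 divr_gt0// pi_gt0.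
  move=> h.
  rewrite -[LHS]mul1e -(@divff _ (Num.sqrt (pi / c))) ?gt_eqF// EFinM -muleA h.
  by rewrite mule1.
- exact: (@continuous_measurable_EFin (fun x => expR (- (c * x ^+ 2))) setT
    (@continuous_expR_sqr c)).
- exact: normal_peak_ge0.
Qed.

End Integrals.

(** * Integral of the correction term *)

Section GaussianExcess.
Variable R : realType.
Implicit Types (x A M D : R).
Local Notation mu := (@lebesgue_measure R).

(** The last factor of [gauss_defect] at [Y = A x ^ 2]. *)
Definition gauss_excess A M x : R :=
  Num.max 0 (A * x ^+ 2 - M) * expR (- (A * x ^+ 2)).

Lemma gauss_excess_ge0 A M x : 0 <= gauss_excess A M x.
Proof. by rewrite mulr_ge0 ?expR_ge0// le_max lexx. Qed.

Lemma continuous_gauss_excess A M : continuous (gauss_excess A M).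
Proof.
move=> x; apply: cvgM; last exact: (@continuous_expR_sqr R A).
have cg : {for x, continuous (fun x => A * x ^+ 2 - M)}.
  apply: (@has_deriv_continuous _ _ _ (A * (2 * x))).
  by has_deriv_tac; ring.
apply: (@continuous_max _ _ (fun=> 0) (fun x => A * x ^+ 2 - M)) => //.
exact: cvg_cst.
Qed.

(* Modelled on the first two terms of the asymptotic expansion at infinity of the
   tail integral of [x ^ 2 * expR (- (A * x ^ 2))]; [D] is free, to be tuned so
   that the derivative dominates [gauss_excess]. *)
Definition excess_primitive A D x : R :=
  - (x / 2 - D / A * x^-1) * expR (- (A * x ^+ 2)).

Definition excess_majorant A D x : R :=
  (A * x ^+ 2 - 2 * D - 2^-1 - D / A * x ^- 2) * expR (- (A * x ^+ 2)).

Lemma has_deriv_excess_primitive A D x : 0 < A -> x != 0 ->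
  has_deriv (excess_primitive A D) x (excess_majorant A D x).
Proof.
move=> A0 x0; rewrite /excess_primitive /excess_majorant; has_deriv_tac => //.
by move: (expR _) => e; field; rewrite x0 gt_eqF.
Qed.

Lemma cvg_excess_primitive A D : 0 < A -> 0 <= D ->
  (* The primitive is squeezed between [- C / x] and [C / x]: the term in [x / 2] uses
     [exp (- A x ^ 2) <= 1 / (A x ^ 2)], the other one [exp (- A x ^ 2) <= 1]. *)
  excess_primitive A D x @[x --> +oo] --> (0 : R).
Proof.
move=> A0 D0; pose C := (2 * A)^-1 + D / A.
have xV : (fun x : R => x^-1) @ +oo --> (0 : R).
  apply/(@gtr0_cvgV0 _ _ _ _ (fun x : R => x)); last exact: cvg_id.
  exact: nbhs_pinfty_gt.
apply: (@squeeze_cvgr _ _ _ _ (fun x => - (C * x^-1)) (fun x => C * x^-1)).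
- near=> x; rewrite -ler_norml.
  have x1 : 1 <= x by near: x; apply: nbhs_pinfty_ge; rewrite num_real.
  have x0 : 0 < x by exact: lt_le_trans x1.
  rewrite /excess_primitive normrM normrN (ger0_norm (expR_ge0 _)).
  have e1 : expR (- (A * x ^+ 2)) <= 1.
    by rewrite expR_le1 oppr_le0 mulr_ge0 ?sqr_ge0// ltW.
  have e2 : expR (- (A * x ^+ 2)) <= (A * x ^+ 2)^-1.
    rewrite expRN lef_pV2 ?posrE ?expR_gt0 ?mulr_gt0 ?exprn_gt0//.
    by apply: le_trans (expR_ge1Dx _); rewrite lerDr.
  have e0 := expR_ge0 (- (A * x ^+ 2)).
  apply: (@le_trans _ _ ((x / 2 + D / A * x^-1) * expR (- (A * x ^+ 2)))).
    rewrite ler_wpM2r//; apply: (le_trans (ler_normB _ _)).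
    have DA : 0 <= D / A by rewrite divr_ge0// ltW.
    rewrite ger0_norm ?ger0_norm// ?mulr_ge0 ?invr_ge0//; exact: ltW.
  rewrite mulrDl /C [leRHS]mulrDl lerD//.
    apply: (@le_trans _ _ (x / 2 * (A * x ^+ 2)^-1)).
      by rewrite ler_wpM2l// divr_ge0// ltW.
    by rewrite le_eqVlt; apply/orP; left; apply/eqP; field; rewrite !gt_eqF.
  by rewrite ler_piMr// mulr_ge0 ?divr_ge0 ?invr_ge0// ltW.
- rewrite -oppr0 -[X in - X](mulr0 C); apply: cvgN; apply: cvgM => //.
  exact: cvg_cst.
- by rewrite -[X in _ --> X](mulr0 C); apply: cvgM => //; exact: cvg_cst.
Unshelve. all: by end_near. Qed.

(** The excess is even and vanishes up to [a = sqrt (M / A)]. Past [a] one has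
    [D / (A x ^ 2) <= D / M], so the condition on [D] puts the majorant above it; the bound is minus
    twice the primitive at [a]. *)
Lemma integral_gauss_excess_le A M D : 0 < A -> 0 < M -> 0 <= D ->
  2 * D + 2^-1 + D / M <= M ->
  (\int[mu]_x (gauss_excess A M x)%:E <=
   ((M - 2 * D) / Num.sqrt M * expR (- M) / Num.sqrt A)%:E)%E.
Proof.
move=> A0 M0 D0 DM.
pose a := Num.sqrt M / Num.sqrt A.
have sM0 : 0 < Num.sqrt M by rewrite sqrtr_gt0.
have sA0 : 0 < Num.sqrt A by rewrite sqrtr_gt0.
have sME : Num.sqrt M ^+ 2 = M by rewrite sqr_sqrtr// ltW.
have sAE : Num.sqrt A ^+ 2 = A by rewrite sqr_sqrtr// ltW.
have a0 : 0 < a by rewrite divr_gt0.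
have aE : A * a ^+ 2 = M.
  by rewrite /a expr_div_n sME sAE mulrC divfK// gt_eqF.
have le_a x : a <= x -> M <= A * x ^+ 2.
  move=> ax; rewrite -aE ler_pM2l// ler_sqr ?nnegrE ?(ltW a0)//.
  exact: le_trans (ltW a0) ax.
have maj x : a <= x ->
    0 <= A * x ^+ 2 - M <= A * x ^+ 2 - 2 * D - 2^-1 - D / A * x ^- 2.
  move=> ax; have := le_a _ ax => h; have x0 : 0 < x by exact: lt_le_trans ax.
  have : D / A * x ^- 2 <= D / M.
    rewrite -mulrA -invfM ler_wpM2l// lef_pV2 ?posrE ?mulr_gt0 ?exprn_gt0//.
  by lra.
rewrite ge0_symfun_integralT; last 3 first.
- by move=> x; exact: gauss_excess_ge0.
- exact: continuous_gauss_excess.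
- by move=> x; rewrite /gauss_excess /= sqrrN.
have -> : (\int[mu]_(x in [set x : R | (0 <= x)%R]) (gauss_excess A M x)%:E =
    \int[mu]_(x in `[a, +oo[) (gauss_excess A M x)%:E)%E.
  have -> : `[a, +oo[%classic = [set x : R | 0 <= x] `&` `[a, +oo[%classic.
    apply/seteqP; split => x /=; rewrite in_itv/= andbT; last by case.
    by move=> ax; split => //; exact: le_trans (ltW a0) ax.
  rewrite integral_mkcondr; apply: eq_integral => x; rewrite inE/= => x0.
  rewrite patchE; case: ifPn => //; rewrite notin_setE/= in_itv/= andbT => /negP.
  rewrite -ltNge => xa; rewrite /gauss_excess.
  suff -> : Num.max 0 (A * x ^+ 2 - M) = 0 by rewrite mul0r.
  apply/max_idPl; rewrite subr_le0 -aE ler_pM2l// ler_sqr ?nnegrE ?(ltW a0)//.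
  exact: ltW.
have dP x : a <= x -> has_deriv (excess_primitive A D) x (excess_majorant A D x).
  by move=> ax; apply: has_deriv_excess_primitive => //; rewrite gt_eqF// (lt_le_trans a0).
have cmaj : {within `[a, +oo[, continuous (excess_majorant A D)}.
  apply: derivable_within_continuous => x; rewrite in_itv/= andbT => ax.
  have x0 : x != 0 by rewrite gt_eqF// (lt_le_trans a0).
  apply: (@has_deriv_derivable _ _ _ _ _).
  apply: has_derivM; last exact: has_deriv_expR_sqr.
  by has_deriv_tac; [rewrite expf_neq0 | reflexivity].
have majF : (\int[mu]_(x in `[a, +oo[) (excess_majorant A D x)%:E =
    (0 : R)%:E - (excess_primitive A D a)%:E)%E.
  apply: ge0_continuous_FTC2y.
  - move=> x /maj /andP[h1 h2]; rewrite mulr_ge0 ?expR_ge0//.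
    exact: le_trans h1 h2.
  - exact: cmaj.
  - exact: cvg_excess_primitive.
  - by move=> x /ltW ax; exact: has_deriv_derivable (dP _ ax).
  - by apply: cvg_at_right_filter; exact: has_deriv_continuous (dP _ (lexx a)).
  - by move=> x; rewrite in_itv/= andbT => /ltW ax; exact: has_deriv_derive1 (dP _ ax).
apply: (@le_trans _ _ (2%:E * ((0 : R)%:E - (excess_primitive A D a)%:E))%E).
  apply: lee_wpmul2l => //; rewrite -majF; apply: ge0_le_integral => //.
  - by move=> x _; rewrite lee_fin gauss_excess_ge0.
  - exact: (@continuous_measurable_EFin _ _ _ (@continuous_gauss_excess A M)).
  - apply/measurable_EFinP; apply: subspace_continuous_measurable_fun; [by []|exact: cmaj].
  - move=> x; rewrite /= in_itv/= andbT => /maj /andP[h1 h2]; rewrite lee_fin.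
    rewrite ler_wpM2r ?expR_ge0//; move/max_idPr: (h1) => ->; exact: h2.
rewrite -EFinB -EFinM lee_fin /excess_primitive aE sub0r.
rewrite le_eqVlt; apply/orP; left; apply/eqP.
rewrite /a; clear -sME sAE sM0 sA0.
move: (expR _) (Num.sqrt M) (Num.sqrt A) sME sAE sM0 sA0 => e m b <- <- m0 b0.
by field; rewrite !gt_eqF.
Qed.

End GaussianExcess.

(** * Numerical inequalities *)

Section Numerics.
Variable R : realType.
Implicit Types (q t A N M : R).

Lemma expR_neg_2ln3 : expR (- (2 * ln 3)) = 9^-1 :> R.
Proof.
rewrite expRN (expRM_natl 2) lnK ?posrE; last by lra.
by congr (_^-1); rewrite -natrX.
Qed.

(* The left-hand side is the bound of [integral_gauss_excess_le] for [D = 2 / 3],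
   up to the scale; [1 - sqrt (3 / pi)] is what the main lobe leaves over. *)
Lemma excess_constant_le (M := 2 * ln 3 : R) :
  (M - 2 * (2 / 3)) / Num.sqrt M * expR (- M) * Num.sqrt (3 / pi ^+ 2) <=
  (1 - Num.sqrt (3 / pi)) * (M - 2^-1).
Proof.
have pi3 := pi_gt_91_29 R; have p0 := pi_gt0 R.
have [l1 l2] := (ln3_ge R, ln3_le R).
have M1 : 109 / 50 <= M by rewrite /M; lra.
have M2 : M <= 111 / 50 by rewrite /M; lra.
rewrite expR_neg_2ln3; move: M M1 M2 => {l1 l2}M M1 M2.
(* The final margin is below two percent, so each square root gets a close rational bound, checked
   by squaring. *)
have sM : 31 / 21 <= Num.sqrt M.
  rewrite -[leLHS]ger0_norm; last by lra.
  by rewrite -sqrtr_sqr ler_sqrt; lra.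
have sk : Num.sqrt (3 / pi ^+ 2) <= 21 / 38 :> R.
  rewrite -[leRHS]ger0_norm; last by lra.
  rewrite -sqrtr_sqr ler_sqrt ?sqr_ge0// ler_pdivrMr ?exprn_gt0//.
  have : (91 / 29) ^+ 2 <= pi ^+ 2 :> R.
    by apply: lerXn2r; rewrite ?nnegrE; lra.
  by lra.
have sg : Num.sqrt (3 / pi) <= 44 / 45 :> R.
  rewrite -[leRHS]ger0_norm; last by lra.
  by rewrite -sqrtr_sqr ler_sqrt ?sqr_ge0// ler_pdivrMr//; lra.
have sM0 : 0 < Num.sqrt M by rewrite (lt_le_trans _ sM)//; lra.
(* Here [133 / 150 = 111 / 50 - 4 / 3], from the upper bound on [M]. *)
have K1 : (M - 2 * (2 / 3)) / Num.sqrt M <= (133 / 150) / (31 / 21).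
  by apply: ler_pM; rewrite ?invr_ge0 ?(ltW sM0) ?lef_pV2 ?posrE//; lra.
have K0 : 0 <= (M - 2 * (2 / 3)) / Num.sqrt M by rewrite divr_ge0 ?(ltW sM0)//; lra.
have k0 : 0 <= Num.sqrt (3 / pi ^+ 2) :> R by exact: sqrtr_ge0.
move: (_ / Num.sqrt M) (Num.sqrt (3 / pi ^+ 2)) (Num.sqrt (3 / pi))
  sk sg K1 K0 k0 => K k g.
move=> sk sg K1 K0 k0.
have h : K * k <= 133 / 150 / (31 / 21) * (21 / 38) by exact: ler_pM.
apply: (@le_trans _ _ (45^-1 * (109 / 50 - 2^-1))); first by lra.
by apply: ler_pM; lra.
Qed.

(** Bounding the affine factor by [exp ((q - 1) (M - 1 / 2))] cancels [M] and leaves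
    [exp (- (q - 1) / 2)]; its square is at most [1 / q] because [exp (q - 1) >= q]. *)
Lemma expR_mul_affine_le_sqrtV q M : 1 <= q -> 0 <= M - 2^-1 ->
  expR (- ((q - 1) * M)) * (1 + (q - 1) * (M - 2^-1)) <= Num.sqrt q^-1.
Proof.
move=> q1 M0; have q0 : 0 < q by lra.
have h1 : 1 + (q - 1) * (M - 2^-1) <= expR ((q - 1) * (M - 2^-1)).
  exact: expR_ge1Dx.
apply: (@le_trans _ _ (expR (- ((q - 1) / 2)))).
  apply: (@le_trans _ _ (expR (- ((q - 1) * M)) * expR ((q - 1) * (M - 2^-1)))).
    by rewrite ler_wpM2l// expR_ge0.
  by rewrite -expRD ler_expR le_eqVlt; apply/orP; left; apply/eqP; field.
rewrite -[leLHS]ger0_norm ?expR_ge0// -sqrtr_sqr ler_sqrt; last first.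
  by rewrite invr_ge0 ltW.
rewrite -expRM_natl (_ : _ * _ = - (q - 1)); last by field.
rewrite expRN lef_pV2 ?posrE ?expR_gt0//.
by have := expR_ge1Dx (q - 1); rewrite (_ : 1 + (q - 1) = q)//; ring.
Qed.

End Numerics.

(** * Integral of the Gaussian majorant *)

Section Comparison.
Variable R : realType.
Implicit Types (p q A M : R) (n : nat).
Local Notation mu := (@lebesgue_measure R).

Lemma continuous_gauss_defect q M A :
  continuous (fun x : R => gauss_defect q M (A * x ^+ 2)).
Proof.
move=> x; rewrite /gauss_defect; apply: cvgD; [apply: cvgB|apply: cvgM].
- have := @continuous_expR_sqr R (q * A) x.
  by under eq_fun do rewrite -mulrA.
- by apply: cvgM; [exact: cvg_cst|exact: continuous_expR_sqr].
- exact: cvg_cst.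
- exact: continuous_gauss_excess.
Qed.

Lemma ge0_integral_continuousD (D : set R) (f g : R -> R) (c : R) :
  measurable D -> continuous f -> continuous g -> 0 <= c ->
  (forall x, D x -> 0 <= f x) -> (forall x, D x -> 0 <= g x) ->
  (\int[mu]_(x in D) (f x + c * g x)%:E =
   \int[mu]_(x in D) (f x)%:E + c%:E * \int[mu]_(x in D) (g x)%:E)%E.
Proof.
move=> mD cf cg c0 f0 g0.
have mf := @continuous_measurable_EFin _ _ D cf.
have mg := @continuous_measurable_EFin _ _ D cg.
rewrite -ge0_integralZl_EFin//.
rewrite -ge0_integralD//.
- by move=> x /g0 gx; rewrite mule_ge0// lee_fin.
- exact: measurable_funeM.
Qed.

Lemma integral_gauss_defect_le q M A (r : R) : 1 <= q -> 0 < A ->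
  (\int[mu]_x (gauss_excess A M x)%:E <= r%:E)%E ->
  (\int[mu]_x (gauss_defect q M (A * x ^+ 2))%:E <=
    (Num.sqrt (pi / (q * A)) - expR (- ((q - 1) * M)) * Num.sqrt (pi / A)
     + expR (- ((q - 1) * M)) * (q - 1) * r)%:E)%E.
Proof.
move=> q1 A0 hr; set w := expR (- ((q - 1) * M)).
have w0 : 0 <= w by exact: expR_ge0.
have c0 : 0 <= w * (q - 1) by rewrite mulr_ge0// subr_ge0.
have qA0 : 0 < q * A by rewrite mulr_gt0//; lra.
(* The subtracted Gaussian is moved to the left, so that additivity is applied to nonnegative
   functions only; its finite integral is subtracted afterwards. *)
have e : (\int[mu]_x (gauss_defect q M (A * x ^+ 2))%:E +
    w%:E * \int[mu]_x (expR (- (A * x ^+ 2)))%:E =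
    \int[mu]_x (expR (- (q * A * x ^+ 2)))%:E +
    (w * (q - 1))%:E * \int[mu]_x (gauss_excess A M x)%:E)%E.
  rewrite -(ge0_integral_continuousD measurableT
    (@continuous_gauss_defect q M A) (@continuous_expR_sqr R A) w0);
    last 2 first.
  - by move=> x _; exact: gauss_defect_ge0.
  - by move=> x _; exact: expR_ge0.
  rewrite -(ge0_integral_continuousD measurableT
    (@continuous_expR_sqr R (q * A)) (@continuous_gauss_excess R A M) c0);
    last 2 first.
  - by move=> x _; exact: expR_ge0.
  - by move=> x _; exact: gauss_excess_ge0.
  apply: eq_integral => x _; congr EFin.
  by rewrite /gauss_defect /gauss_excess -/w mulrA; ring.
rewrite addrAC EFinB leeBrDr// -[X in (_ + X <= _)%E]EFinM.
rewrite EFinM -(integral_expR_sqr A0) e EFinD -(integral_expR_sqr qA0).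
by rewrite leeD2l// (EFinM (w * (q - 1)) r) lee_wpmul2l// lee_fin.
Qed.

End Comparison.

(** * Assembly of the estimate *)

Unset Implicit Arguments.
Set Strict Implicit.

Theorem theorem1p7 (R : realType) (p : R) (n : nat)
    (hp : 2 <= p) (hn : (2 <= n)%N) :
  (\int[@lebesgue_measure R]_(x in `[(- 2^-1)%R, 2^-1%R]) (sine_ratio_pow n p x)%:E
     < (Num.sqrt (2 / (p * (n%:R ^+ 2 - 1)))%R)%:E)%E.
Proof.
have n0 : (0 < n)%N by exact: ltn_trans hn.
have hn' : (2 : R) <= n%:R by rewrite ler_nat.
have p0 := pi_gt0 R.
(* This [M] makes [exp (- M)] the side-lobe bound [1 / 9]. *)
pose q := p / 2; pose M : R := 2 * ln 3; pose w := expR (- ((q - 1) * M)).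
pose N2 : R := n%:R ^+ 2 - 1; pose A := N2 * pi ^+ 2 / 3.
have q1 : 1 <= q by rewrite /q; lra.
have N20 : 0 < N2 by rewrite /N2; nra.
have A0 : 0 < A by rewrite divr_gt0// mulr_gt0// exprn_gt0.
have M1 : 109 / 50 <= M by rewrite /M; have := ln3_ge R; lra.
have w0 : 0 < w by exact: expR_gt0.
pose K := (M - 2 * (2 / 3)) / Num.sqrt M * expR (- M).
have hK : (\int[@lebesgue_measure R]_x (gauss_excess A M x)%:E <=
    (K / Num.sqrt A)%:E)%E.
  apply: integral_gauss_excess_le => //; first by lra.
  (* With [D = 2 / 3] the condition [2 D + 1 / 2 + D / M <= M] just holds at [M = 109 / 50]. *)
  have : 2 / 3 / M <= 2 / 3 / (109 / 50).
    by rewrite ler_pM2l ?lef_pV2 ?posrE//; lra.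
  by lra.
have hB := integral_gauss_defect_le q1 A0 hK.
have abs2 (x : R) : `[(- 2^-1)%R, 2^-1%R]%classic x -> `|x| <= 2^-1.
  by rewrite /= in_itv/= ler_norml.
have pw x : `|x| <= 2^-1 -> sine_ratio_pow n p x <=
    gauss_defect q M (A * x ^+ 2) + w * fejer_mean n x.
  move=> x2; rewrite sine_ratio_powE// addrC.
  apply: powR_le_gauss_defect => //; first exact: fejer_mean_ge0.
  have [xn|nx] := leP `|x| n%:R^-1; first by right; exact: fejer_mean_main_lobe.
  by left; rewrite expR_neg_2ln3 fejer_mean_side_lobes// ltW.
apply: (@le_lt_trans _ _ (\int[@lebesgue_measure R]_(x in `[(- 2^-1)%R, 2^-1%R])
    (gauss_defect q M (A * x ^+ 2) + w * fejer_mean n x)%:E)%E).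
  apply: ge0_le_integral => //.
  - move=> x /abs2 x2; rewrite lee_fin sine_ratio_powE//; exact: powR_ge0.
  - apply: (@eq_measurable_fun _ _ _ _ _ (fun x => (fejer_mean n x `^ q)%:E)).
      by move=> x /set_mem /abs2 x2; rewrite sine_ratio_powE.
    apply/measurable_EFinP; apply: (measurableT_comp (measurable_powR _)).
    apply: measurable_funTS; apply: continuous_measurable_fun.
    exact: continuous_fejer_mean.
  - apply: continuous_measurable_EFin => x.
    apply: cvgD; first exact: continuous_gauss_defect.
    by apply: cvgM; [exact: cvg_cst|exact: continuous_fejer_mean].
  - by move=> x /abs2 x2; rewrite lee_fin pw.
rewrite (ge0_integral_continuousD (measurable_itv _)
  (@continuous_gauss_defect R q M A) (@continuous_fejer_mean R n) (ltW w0));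
  last 2 first.
- by move=> x _; exact: gauss_defect_ge0.
- by move=> x /abs2 x2; exact: fejer_mean_ge0.
rewrite integral_fejer_mean//.
(* The defect is nonnegative, so its integral may be extended to the whole line. *)
apply: (@le_lt_trans _ _
  (\int[@lebesgue_measure R]_x (gauss_defect q M (A * x ^+ 2))%:E +
    w%:E * (n%:R^-1)%:E)%E).
  rewrite leeD2r//; apply: ge0_subset_integral => //.
  - exact: (@continuous_measurable_EFin _ _ _ (@continuous_gauss_defect R q M A)).
  - by move=> x _; rewrite lee_fin gauss_defect_ge0.
apply: (le_lt_trans (leeD2r _ hB)); rewrite -EFinM -EFinD lte_fin.
(* [T] carries the dependence on [n], and every term but [w / n] is a multiple of it; the target is
   [S * T]. *)
pose T := Num.sqrt N2^-1; pose S := Num.sqrt q^-1.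
have T0 : 0 < T by rewrite sqrtr_gt0 invr_gt0.
have nT : n%:R^-1 < T.
  rewrite -[ltLHS]ger0_norm ?invr_ge0// -sqrtr_sqr ltr_sqrt ?invr_gt0//.
  by rewrite exprVn ltf_pV2 ?posrE// ?exprn_gt0// /N2; lra.
pose g : R := Num.sqrt (3 / pi); pose k : R := Num.sqrt (3 / pi ^+ 2).
have q0 : 0 < q by lra.
have qV0 : 0 <= q^-1 by rewrite invr_ge0 ltW.
have g0 : (0 : R) <= 3 / pi by rewrite divr_ge0// ltW.
have k0 : (0 : R) <= 3 / pi ^+ 2 by rewrite divr_ge0// sqr_ge0.
have -> : Num.sqrt (2 / (p * N2)) = S * T.
  rewrite /S /T -(sqrtrM _ qV0); congr Num.sqrt.
  by rewrite /q; field; rewrite !gt_eqF//; lra.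
have -> : Num.sqrt (pi / (q * A)) = g * (S * T).
  rewrite /g /S /T -(sqrtrM _ qV0) -(sqrtrM _ g0); congr Num.sqrt.
  by rewrite /A; move: (pi : R) p0 => a a0; field; rewrite !gt_eqF.
have -> : Num.sqrt (pi / A) = g * T.
  rewrite /g /T -(sqrtrM _ g0); congr Num.sqrt.
  by rewrite /A; move: (pi : R) p0 => a a0; field; rewrite !gt_eqF.
have -> : K / Num.sqrt A = K * k * T.
  rewrite /k /T -mulrA -(sqrtrM _ k0) -sqrtrV ?(ltW A0)//; congr (_ * Num.sqrt _).
  by rewrite /A; move: (pi : R) p0 => a a0; field; rewrite !gt_eqF.
have hk : K * k <= (1 - g) * (M - 2^-1) := excess_constant_le R.
have hS : w * (1 + (q - 1) * (M - 2^-1)) <= S.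
  by apply: expR_mul_affine_le_sqrtV => //; lra.
have g1 : g <= 1.
  rewrite -sqrtr1 ler_sqrt// ler_pdivrMr// mul1r; have := pi_gt_91_29 R; lra.
(* The strictness of the theorem comes from here. What remains is
   [w (1 - g) + w (q - 1) K k <= (1 - g) S], the common factor [1 - g] appearing once [K k] is
   bounded. *)
have h1 : w / n%:R < w * T by rewrite ltr_pM2l.
have h2 : w * (q - 1) * (K * k) <= w * (q - 1) * ((1 - g) * (M - 2^-1)).
  by rewrite ler_wpM2l// mulr_ge0 ?(ltW w0)// subr_ge0.
have h3 : (1 - g) * (w * (1 + (q - 1) * (M - 2^-1))) <= (1 - g) * S.
  by rewrite ler_wpM2l// subr_ge0.
have h4 : (w * (1 - g) + w * (q - 1) * (K * k)) * T <= (1 - g) * S * T.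
  by rewrite ler_pM2r//; lra.
by rewrite -/w; lra.
Qed.
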